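(* There exists a constant $C$ such that for every integer $n\geq 2$, $$\sup_{x\in[0,1]}\left|\frac{\ln(f_n(x))}{n\ln n}-(1-x)\right|\leq \frac{C}{\ln n},$$ where $f_n:[0,1]\to\mathbb{R}$ is defined by $f_n(x)=c(n,[nx])$ if $x\geq \frac1n$ and $f_n(x)=c(n,1)$ otherwise, $[y]$ denoting the integer part of $y$.
   Context: For a permutation $\sigma=a_1a_2\cdots a_n$ of $\{1,\dots,n\}$ (in one-line notation), a record of $\sigma$ is a value $a_j$ such that $a_i<a_j$ for all $i<j$. For integers $n\geq1$ and $k$, $c(n,k)$ denotes the number of permutations of $\{1,\dots,n\}$ having exactly $k$ records; equivalently, $c(n,k)$ is the coefficient of $q^k$ in $q(q+1)\cdots(q+n-1)$. *)

(* Defs.v *)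
From mathcomp Require Import all_boot all_order all_fingroup all_algebra.
From mathcomp Require Import all_classical all_reals all_analysis.

Set Implicit Arguments.
Unset Strict Implicit.
Unset Printing Implicit Defensive.

Import Order.TTheory GRing.Theory Num.Theory.
Local Open Scope ring_scope.

(* Permutations of {1, ..., n} are represented by 'S_n, acting on
   {0, ..., n - 1}: both positions and values are shifted by one. *)
Definition is_record (n : nat) (s : 'S_n) (j : 'I_n) : bool :=
  [forall i : 'I_n, (i < j)%N ==> (s i < s j)%N].

(* Since s is injective, counting the positions of the records is the same as
   counting their values. *)
Definition nb_records (n : nat) (s : 'S_n) : nat := #|[set j | is_record s j]|.

Definition c (n k : nat) : nat := #|[set s : 'S_n | nb_records s == k]|.

(* For y >= 0, Num.truncn y is the integer part of y, as a natural number. *)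
Definition f (R : realType) (n : nat) (x : R) : R :=
  if n%:R^-1 <= x then (c n (Num.truncn (n%:R * x)))%:R else (c n 1)%:R.

(* Main.v *)
(** Deleting the last entry of a permutation gives the recurrence
    [c(n+1, k+1) = c(n, k) + n c(n, k+1)], from which
    [n! <= c(n, k) n^k <= binomial(n, k) n^n] for [1 <= k <= n] by induction.
    As [n^n <= binomial(2n, n) n! <= 4^n n!], taking logarithms yields
    [|ln c(n, k) - (n - k) ln n| <= n ln 4].  Replacing [k = [nx]] by [nx] costs
    at most [ln n <= n], and dividing by [n ln n] gives the bound with
    [C = ln 4 + 1]. *)
Require Import Defs.
From mathcomp Require Import all_boot all_order all_fingroup all_algebra.
From mathcomp Require Import all_classical all_reals all_analysis.
From mathcomp Require Import ring lra.

Import Order.TTheory GRing.Theory Num.Theory.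
Local Open Scope classical_set_scope.
Local Open Scope ring_scope.

Lemma nb_records_sum (n : nat) (s : 'S_n) :
  nb_records s = (\sum_(j < n) is_record s j)%N.
Proof.
rewrite /nb_records -sum1_card big_mkcond; apply: eq_bigr => j _.
by rewrite inE; case: is_record.
Qed.

(** [lift_perm ord_max j s] appends the value [j] to [s] after an increasing relabelling of the
    earlier values. This keeps the earlier records, and the new last entry is a record only when it
    is the maximum. *)
Lemma nb_records_lift_perm (n : nat) (j : 'I_n.+1) (s : 'S_n) :
  nb_records (lift_perm ord_max j s) = (nb_records s + (j == ord_max))%N.
Proof.
have lt_lift_max (k : 'I_n) : (lift ord_max k < n)%N by rewrite lift_max ltn_ord.
have rec_max : is_record (lift_perm ord_max j s) ord_max = (j == ord_max).
  apply/forallP/eqP => [h|->].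
    (* If [j] is not the maximum, then the maximum sits at an earlier position and prevents the last
       entry from being a record. *)
    apply/eqP; case: (unliftP ord_max j) => [m jE|->//]; exfalso.
    have [i si] : exists i, s i = m by exists (s^-1%g m); rewrite permKV.
    case: (unliftP j ord_max) => [i' maxE|maxE]; last first.
      by have := neq_lift ord_max m; rewrite -jE maxE eqxx.
    have := h (lift ord_max (s^-1%g i')); rewrite lt_lift_max /=.
    rewrite lift_perm_id lift_perm_lift permKV -maxE /=.
    by rewrite ltnNge -ltnS ltn_ord.
  move=> i; apply/implyP => ilt.
  case: (unliftP ord_max i) ilt => [m ->|->]; last by rewrite ltnn.
  by rewrite lift_perm_id lift_perm_lift lt_lift_max.
have rec_lift k :
    is_record (lift_perm ord_max j s) (lift ord_max k) = is_record s k.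
  have lt_lift (m : 'I_n.+1) (a b : 'I_n) : (lift m a < lift m b)%N = (a < b)%N.
    by rewrite /= !ltnNge leq_bump2.
  apply/forallP/forallP => h i.
    by have := h (lift ord_max i); rewrite !lift_perm_lift !lt_lift.
  case: (unliftP ord_max i) => [m ->|->].
    by rewrite !lift_perm_lift !lt_lift; exact: h.
  by rewrite ltnNge (ltnW (lt_lift_max k)).
rewrite !nb_records_sum big_ord_recr /= rec_max; congr (_ + _)%N.
apply: eq_bigr => k _; rewrite -rec_lift.
by congr (nat_of_bool (is_record _ _)); apply: val_inj; exact/esym/lift_max.
Qed.

(** The last value gives back [j], the other values give back [s], and both sides have $(n+1)!$
    elements. *)
Lemma lift_perm_bij (n : nat) :
  bijective (fun p : 'I_n.+1 * 'S_n => lift_perm ord_max p.1 p.2).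
Proof.
apply: inj_card_bij; last first.
  by rewrite card_prod !card_Sn card_ord factS.
move=> [j s] [j' s'] /= e.
have jE : j = j' by have := congr1 (fun u : 'S_n.+1 => u ord_max) e;
  rewrite !lift_perm_id.
congr pair => //; apply/permP => i.
have := congr1 (fun u : 'S_n.+1 => u (lift ord_max i)) e.
by rewrite !lift_perm_lift jE => /lift_inj.
Qed.

Lemma c_sum (n k : nat) : c n k = (\sum_(s : 'S_n) (nb_records s == k))%N.
Proof.
rewrite /c -sum1_card big_mkcond; apply: eq_bigr => s _.
by rewrite inE; case: eqP.
Qed.

(** The $n$ non-maximal choices of the last value give the first term, the maximal one gives the
    sum. Leaving the sum unevaluated avoids $k-1$ and covers $k=0$. *)
Lemma c_rec (n k : nat) :
  c n.+1 k = (n * c n k + \sum_(s : 'S_n) ((nb_records s).+1 == k))%N.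
Proof.
rewrite !c_sum (reindex _ (onW_bij _ (lift_perm_bij n))) /=.
rewrite -(pair_bigA _ (fun j s =>
  (nb_records (lift_perm ord_max j s) == k : nat))) /=.
rewrite big_ord_recr /=; congr (_ + _)%N; last first.
  by apply: eq_bigr => s _; rewrite nb_records_lift_perm eqxx addn1.
rewrite -[X in (X * _)%N]card_ord -sum_nat_const.
apply: eq_bigr => j _; apply: eq_bigr => s _.
rewrite nb_records_lift_perm.
by rewrite -val_eqE /= (ltn_eqF (ltn_ord j)) addn0.
Qed.

Lemma cSS (n k : nat) : c n.+1 k.+1 = (c n k + n * c n k.+1)%N.
Proof.
by rewrite c_rec addnC [c n k]c_sum.
Qed.

Lemma c0 (k : nat) : c 0 k = (k == 0)%N.
Proof.
have nb0 (s : 'S_0) : nb_records s = 0%N.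
  by apply/eqP; rewrite cards_eq0; apply/eqP/setP => -[].
rewrite c_sum (eq_bigr (fun=> (k == 0%N : nat))) => [|s _].
  by rewrite sum_nat_const card_Sn mul1n.
by rewrite nb0 eq_sym.
Qed.

Lemma cS0 (n : nat) : c n.+1 0 = 0%N.
Proof.
elim: n => [|n IH]; rewrite c_rec big1 //.
by rewrite IH muln0.
Qed.

Lemma cS1 (n : nat) : c n.+1 1 = n`!.
Proof.
elim: n => [|n IH]; first by rewrite cSS c0.
by rewrite cSS cS0 IH factS.
Qed.

(** The base [N] stays fixed during the induction on [n]. Bounding the factor $n$ of the recurrence
    by $N$ turns it into Pascal's rule. *)
Lemma c_upper (N n k : nat) : (n <= N)%N ->
  (c n k * N ^ k <= 'C(n, k) * N ^ n)%N.
Proof.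
elim: n k => [|n IH] k nN; first by rewrite c0; case: k.
case: k => [|k]; first by rewrite cS0.
have nN' := ltnW nN.
rewrite cSS binS mulnDl mulnDl addnC leq_add //.
  by rewrite -mulnA [in leqRHS]expnS [in leqRHS]mulnCA leq_mul // IH.
by rewrite !expnS mulnCA [in leqRHS]mulnCA leq_mul // IH.
Qed.

(** Keeping only the permutations that end with their maximum lowers $n$ and $k$ together, at the
    price of a factor $n+1\leq N$, down to the exact value at $k=1$. *)
Lemma c_lower (N n k : nat) : (n <= N)%N -> (0 < k <= n)%N ->
  (n`! <= c n k * N ^ k)%N.
Proof.
elim: n k => [|n IH] [|[|k]] nN // /andP[_ kn].
  by rewrite cS1 factS mulnC leq_mul.
rewrite cSS mulnDl (leq_trans _ (leq_addr _ _)) // factS expnS mulnCA.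
by rewrite leq_mul // IH // ltnW.
Qed.

Lemma expn_ffact_leq (n m : nat) : (n ^ m <= (n + m) ^_ m)%N.
Proof.
elim: m => [|m IH]; first by rewrite ffactn0.
by rewrite addnS ffactSS expnS leq_mul // leqW // leq_addr.
Qed.

Lemma bin_leq_exp2 (n k : nat) : ('C(n, k) <= 2 ^ n)%N.
Proof.
have [nk|kn] := ltnP n k; first by rewrite bin_small.
rewrite -[2%N]/(1 + 1)%N expnDn (bigD1 (inord k)) //= inordK ?ltnS //.
by rewrite !exp1n !muln1 leq_addr.
Qed.

Lemma expn_fact_leq (n : nat) : (n ^ n <= 4 ^ n * n`!)%N.
Proof.
apply: leq_trans (expn_ffact_leq n n) _.
rewrite -bin_ffact leq_mul // (leq_trans (bin_leq_exp2 _ _)) //.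
by rewrite addnn -mul2n expnM.
Qed.

Lemma ln_c_bound (R : realType) (n k : nat) : (0 < k <= n)%N ->
  `|ln (c n k)%:R - (n%:R - k%:R) * ln n%:R| <= n%:R * ln 4 :> R.
Proof.
move=> kn; have n0 : (0 < n)%N by case/andP: kn => /leq_trans; apply.
have low : (n ^ n <= 4 ^ n * (c n k * n ^ k))%N.
  by rewrite (leq_trans (expn_fact_leq n)) // leq_mul // c_lower.
(* Here $2^n$ would do; $4^n$ makes the error symmetric with that of [low]. *)
have upp : (c n k * n ^ k <= 4 ^ n * n ^ n)%N.
  rewrite (leq_trans (c_upper n n k (leqnn n))) // leq_mul //.
  by rewrite (leq_trans (bin_leq_exp2 _ _)) // leq_exp2r.
(* Positivity comes from [low], since $n^n>0$; it lets the logarithm of the product split. *)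
have c_gt0 : (0 < c n k)%N.
  by case: (c n k) low => //; rewrite mul0n muln0 leqn0 expn_eq0 eqn0Ngt n0.
have cR : 0 < (c n k)%:R :> R by rewrite ltr0n.
have nR : 0 < n%:R :> R by rewrite ltr0n.
have le_ln (a b : nat) : (0 < a)%N -> (a <= b)%N -> ln a%:R <= ln b%:R :> R.
  move=> a0 ab; rewrite ler_ln ?ler_nat // posrE ltr0n //.
  exact: leq_trans ab.
have lnc : ln (c n k * n ^ k)%:R = ln (c n k)%:R + k%:R * ln n%:R :> R.
  by rewrite natrM natrX lnM ?posrE ?exprn_gt0 // lnXn // mulr_natl.
have lnX a : (0 < a)%N -> ln (a ^ n)%:R = n%:R * ln a%:R :> R.
  by move=> a0; rewrite natrX lnXn ?ltr0n // mulr_natl.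
have low' := le_ln _ _ _ low; have upp' := le_ln _ _ _ upp.
move: low' upp'; rewrite expn_gt0 n0 muln_gt0 c_gt0 expn_gt0 n0.
move=> /(_ isT) + /(_ isT).
rewrite (natrM _ (4 ^ n) (c n k * _)) (natrM _ (4 ^ n) (n ^ n)).
rewrite !lnM ?posrE ?ltr0n ?expn_gt0 ?muln_gt0 ?c_gt0 ?expn_gt0 ?n0 //.
rewrite lnc lnX // lnX // => lo up.
by rewrite ler_norml mulrBl; apply/andP; split; lra.
Qed.

Lemma f_c (R : realType) (n : nat) (x : R) : (0 < n)%N -> 0 <= x <= 1 ->
  exists k : nat,
    [/\ (0 < k <= n)%N, f n x = (c n k)%:R & `|k%:R - n%:R * x| <= 1].
Proof.
move=> n0 /andP[x0 x1]; have nR : 0 < n%:R :> R by rewrite ltr0n.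
have nx0 : 0 <= n%:R * x by rewrite mulr_ge0 // ltW.
rewrite /f; case: ifPn => [nx|]; last first.
  (* Below $1/n$ the product $nx$ lies in $[0,1)$, so $k=1$ is still within distance 1. *)
  rewrite -ltNge => nx; exists 1%N; split => //.
  have : n%:R * x < 1 by rewrite mulrC -ltr_pdivlMr // div1r.
  by rewrite ler_norml => h; apply/andP; split; lra.
have /andP[kle klt] := truncn_itv nx0.
exists (Num.truncn (n%:R * x)); split => //; last first.
  move: klt; rewrite -natr1 => klt.
  by rewrite ler_norml; apply/andP; split; lra.
apply/andP; split.
  by rewrite truncn_gt0 mulrC -ler_pdivrMr // div1r.
by rewrite -(ler_nat R) (le_trans kle) // ler_piMr // ltW.
Qed.

Theorem theorem3p1 (R : realType) :
  exists C : R, forall n : nat, (2 <= n)%N ->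
    (ereal_sup [set `| ln (f n x) / (n%:R * ln n%:R) - (1 - x) |%:E
               | x in `[0%R, 1%R]%classic]
     <= (C / ln n%:R)%:E)%E.
Proof.
exists (ln 4 + 1) => n n2; have n0 : (0 < n)%N by exact: ltnW.
have nR : 0 < n%:R :> R by rewrite ltr0n.
have lnR : 0 < ln n%:R :> R by rewrite ln_gt0 // ltr1n.
have ln_n : ln n%:R <= n%:R :> R.
  (* This is $\ln(1+y)\leq y$ at $y=n-1$. *)
  have : ln (1 + (n%:R - 1)) <= n%:R - 1 :> R by apply: le_ln1Dx; lra.
  by rewrite (addrC 1) subrK; lra.
apply: ge_ereal_sup => _ [x /= + <-].
rewrite in_itv /= => /(f_c _ _ _ n0) [k [kn -> kx]]; rewrite lee_fin.
have -> : ln (c n k)%:R / (n%:R * ln n%:R) - (1 - x) =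
    (ln (c n k)%:R - n%:R * (1 - x) * ln n%:R) / (n%:R * ln n%:R).
  by field; rewrite !gt_eqF.
rewrite normrM normfV [`|n%:R * _|]gtr0_norm ?mulr_gt0 //.
rewrite ler_pdivrMr ?mulr_gt0 //.
have -> : (ln 4 + 1) / ln n%:R * (n%:R * ln n%:R) = n%:R * ln 4 + n%:R :> R.
  by field; rewrite gt_eqF.
(* The first difference is bounded by [ln_c_bound]; the second is the rounding error, at most $\ln
   n\leq n$. *)
have -> : ln (c n k)%:R - n%:R * (1 - x) * ln n%:R =
    (ln (c n k)%:R - (n%:R - k%:R) * ln n%:R) - (k%:R - n%:R * x) * ln n%:R.
  by ring.
rewrite (le_trans (ler_normB _ _)) // lerD ?ln_c_bound //.
by rewrite normrM (gtr0_norm lnR) (le_trans _ ln_n) // ler_piMl // ltW.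
Qed.
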